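(* Let $c>0$ and $v\in\mathbb{R}^d$. For $i=1,\dots,m$ let $u_i\in\mathbb{R}^d$ and let $p_i$ be a probability density on $\mathbb{R}^d$ of the form $p_i(y)=\phi_i(\|y-u_i\|)$ for some function $\phi_i$. Suppose $v=\sum_{i=1}^m w_iu_i$ with $w_i\ge0$, $\sum_{i=1}^m w_i=1$, and $\langle u_i,v\rangle\ge0$ for all $i$. Let $\xi$ have the zero-mean mixture density $p'(\xi)=\sum_{i=1}^m w_i\,p_i(\xi+v)$ (i.e. $v+\xi$ has density $\sum_i w_ip_i$), and let $g=\mathrm{clip}(v+\xi,c)$. Then $$\mathbb{E}_{\xi\sim p'}[\langle v,g\rangle]\ge\|v\|\sum_{i=1}^m w_i\min\left(\|u_i\|,\frac34c\right)\cos(v,u_i)\,\mathbb{P}_{y\sim p_i}\left(\|y-u_i\|<\frac c4\right)\ge0.$$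
   Context: For $g\in\mathbb{R}^d$ and $c>0$, $\mathrm{clip}(g,c)=g\cdot\min\left(1,\frac{c}{\|g\|}\right)$ (with $\mathrm{clip}(0,c)=0$). $\cos(a,b)=\langle a,b\rangle/(\|a\|\|b\|)$ (terms in which $a$ or $b$ is zero are taken to be $0$). In the paper $v$ is the true gradient $\nabla f(x_t)$. *)

(* Defs.v *)
(* R^d is modelled as d.-tuple R, which carries the
   library's product (= Borel) sigma-algebra generated by the coordinates. *)
From HB Require Import structures.
From mathcomp Require Import all_boot all_order all_algebra.
From mathcomp Require Import all_classical all_reals.
From mathcomp Require Import ereal topology normedtype sequences measure
  lebesgue_measure lebesgue_integral.
Set Implicit Arguments. Unset Strict Implicit. Unset Printing Implicit Defensive.
Import Order.TTheory GRing.Theory Num.Theory.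
Local Open Scope classical_set_scope.
Local Open Scope ring_scope.

Section vec.
Context {R : realType} {d : nat}.
Implicit Types x y : d.-tuple R.

Definition vadd x y : d.-tuple R := [tuple tnth x i + tnth y i | i < d].
Definition vsub x y : d.-tuple R := [tuple tnth x i - tnth y i | i < d].
Definition vscale (a : R) x : d.-tuple R := [tuple a * tnth x i | i < d].
Definition vzero : d.-tuple R := [tuple (0 : R) | i < d].
Definition dotv x y : R := \sum_(i < d) tnth x i * tnth y i.
Definition normv x : R := Num.sqrt (dotv x x).

Definition clip x (c : R) : d.-tuple R :=
  if normv x == 0 then vzero else vscale (Num.min 1 (c / normv x)) x.

Definition cosv x y : R :=
  if (normv x == 0) || (normv y == 0) then 0
  else dotv x y / (normv x * normv y).

Definition box (a b : d.-tuple R) : set (d.-tuple R) :=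
  [set x | forall i : 'I_d, tnth a i <= tnth x i <= tnth b i].
End vec.

(* lam is (d-dimensional) Lebesgue measure: the measure on the Borel sets of
   R^d giving every box the product of its side lengths.  By uniqueness of
   the extension from the pi-system of boxes this characterizes Lebesgue
   measure on the Borel sigma-algebra. *)
Definition is_lebesgue_measure {R : realType} {d : nat}
  (lam : set (d.-tuple R) -> \bar R) : Prop :=
  forall a b : d.-tuple R, (forall i : 'I_d, tnth a i <= tnth b i) ->
    lam (box a b) = (\prod_(i < d) (tnth b i - tnth a i))%:E.

Definition is_prob_density {R : realType} {d : nat}
  (lam : {measure set (d.-tuple R) -> \bar R}) (p : d.-tuple R -> R) : Prop :=
  measurable_fun setT p /\ (forall y, 0 <= p y) /\
  (\int[lam]_y (p y)%:E = 1)%E.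

(* Main.v *)
(* Write k(y) y = clip(y, c) with 0 <= k(y) <= 1.  It suffices to bound, for each
   i, the mean of <v, k(y) y> under p_i, with u = u_i.  The density p_i is
   invariant under the rotation by pi about the line spanned by u and under the
   point reflection y' = 2u - y.  Averaging over the first replaces y by its
   projection on u, and averaging over the second then leaves
   <v, u> / |u|^2 * (k(y) <y, u> + k(y') <y', u>) / 2.  The bracket is always
   nonnegative, and on the ball |y - u| < c/4 both factors are at least
   min(|u|, 3c/4) / |u| while <y, u> + <y', u> = 2 |u|^2.
   Isometries preserve lam because a translation-invariant measure is
   determined by its value on one symmetric set of positive finite measure. *)
Require Import Defs.
From HB Require Import structures.
From mathcomp Require Import all_boot all_order all_algebra.
From mathcomp Require Import all_classical all_reals.
From mathcomp Require Import ereal topology normedtype sequences measure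
  lebesgue_measure lebesgue_integral.
From mathcomp Require Import measurable_realfun numfun realfun exp.
From mathcomp Require Import ring lra.
Import Order.TTheory GRing.Theory Num.Theory.
Local Open Scope classical_set_scope.
Local Open Scope ring_scope.

(** * Inner product and norm on tuples, up to the triangle inequality *)

Section vectors.
Context {R : realType} {d : nat}.
Implicit Types x y z u : d.-tuple R.

Lemma tnth_vadd x y i : tnth (vadd x y) i = tnth x i + tnth y i.
Proof. by rewrite tnth_mktuple. Qed.

Lemma tnth_vsub x y i : tnth (vsub x y) i = tnth x i - tnth y i.
Proof. by rewrite tnth_mktuple. Qed.

Lemma tnth_vscale a x i : tnth (vscale a x) i = a * tnth x i.
Proof. by rewrite tnth_mktuple. Qed.

Lemma tnth_vzero i : tnth (@vzero R d) i = 0.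
Proof. by rewrite tnth_mktuple. Qed.

Definition tnth_vec := (tnth_vadd, tnth_vsub, tnth_vscale, tnth_vzero).

Lemma dotvC x y : dotv x y = dotv y x.
Proof. by apply: eq_bigr => i _; rewrite mulrC. Qed.

Lemma dotvDl x y z : dotv (vadd x y) z = dotv x z + dotv y z.
Proof.
by rewrite -big_split; apply: eq_bigr => i _ /=; rewrite tnth_vadd mulrDl.
Qed.

Lemma dotvBl x y z : dotv (vsub x y) z = dotv x z - dotv y z.
Proof. by rewrite -sumrB; apply: eq_bigr => i _ /=; rewrite tnth_vsub mulrBl. Qed.

Lemma dotvZl a x z : dotv (vscale a x) z = a * dotv x z.
Proof.
by rewrite mulr_sumr; apply: eq_bigr => i _ /=; rewrite tnth_vscale mulrA.
Qed.

Lemma dotvDr x y z : dotv z (vadd x y) = dotv z x + dotv z y.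
Proof. by rewrite dotvC dotvDl !(dotvC z). Qed.

Lemma dotvBr x y z : dotv z (vsub x y) = dotv z x - dotv z y.
Proof. by rewrite dotvC dotvBl !(dotvC z). Qed.

Lemma dotvZr a x z : dotv z (vscale a x) = a * dotv z x.
Proof. by rewrite dotvC dotvZl (dotvC z). Qed.

Definition dotvE := (dotvDl, dotvBl, dotvZl, dotvDr, dotvBr, dotvZr).

Lemma dotv_ge0 x : 0 <= dotv x x.
Proof. by apply: sumr_ge0 => i _; rewrite -expr2 sqr_ge0. Qed.

Lemma dotv_eq0 x y : dotv x x = 0 -> dotv x y = 0.
Proof.
move=> /psumr_eq0P x0; apply: big1 => i _.
have /eqP : tnth x i * tnth x i = 0 by apply: x0 => // j _; rewrite -expr2 sqr_ge0.
by rewrite mulf_eq0 orbb => /eqP ->; rewrite mul0r.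
Qed.

Lemma sqr_tnth_le x i : tnth x i ^+ 2 <= dotv x x.
Proof.
rewrite /dotv (bigD1 i)//= expr2 lerDl; apply: sumr_ge0 => j _.
by rewrite -expr2 sqr_ge0.
Qed.

(** Cauchy-Schwarz: the square norm of <y, y> x - <x, y> y is nonnegative and equals <y, y> times
    the difference of the two sides. *)
Lemma sqr_dotv_le x y : dotv x y ^+ 2 <= dotv x x * dotv y y.
Proof.
have [y0|ypos] := leP (dotv y y) 0.
  have yy0 : dotv y y = 0 by apply/eqP; rewrite eq_le y0 dotv_ge0.
  by rewrite dotvC dotv_eq0// expr0n/= mulr_ge0 ?dotv_ge0.
have := dotv_ge0 (vsub (vscale (dotv y y) x) (vscale (dotv x y) y)).
rewrite !dotvE (dotvC y x).
rewrite [X in 0 <= X -> _](_ : _ =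
  dotv y y * (dotv x x * dotv y y - dotv x y ^+ 2)); last by ring.
by rewrite pmulr_rge0// subr_ge0.
Qed.

Lemma normv_ge0 x : 0 <= normv x.
Proof. exact: sqrtr_ge0. Qed.

Lemma sqr_normv x : normv x ^+ 2 = dotv x x.
Proof. by rewrite sqr_sqrtr// dotv_ge0. Qed.

Lemma ler_dotv x y : `|dotv x y| <= normv x * normv y.
Proof.
rewrite -(@ler_pXn2r _ 2)// ?nnegrE ?mulr_ge0 ?normv_ge0//.
by rewrite real_normK ?num_real// exprMn !sqr_normv sqr_dotv_le.
Qed.

Lemma ler_normv_sub x y : normv x <= normv y + normv (vsub x y).
Proof.
rewrite -(@ler_pXn2r _ 2)// ?nnegrE ?addr_ge0 ?normv_ge0//.
have h := ler_normlW (ler_dotv y (vsub x y)).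
rewrite sqrrD !sqr_normv; move: h; rewrite !dotvE (dotvC y x) mulr2n; lra.
Qed.

Lemma normv0_tnth x i : normv x = 0 -> tnth x i = 0.
Proof.
move=> x0; apply/eqP; rewrite -sqrf_eq0 eq_le sqr_ge0 andbT.
by have := sqr_tnth_le x i; rewrite -sqr_normv x0 expr0n.
Qed.

End vectors.

(** * Clipping, the two reflections, and pointwise bounds for a reflected pair *)

Section clipping.
Context {R : realType} {d : nat}.
Implicit Types x y z u v : d.-tuple R.

(* The value at normv x = 0 is irrelevant for clip_factor c x * x; with 1 the
   factor is the limit of its values at nonzero vectors. *)
Definition clip_factor (c : R) x : R :=
  if normv x == 0 then 1 else Num.min 1 (c / normv x).

Lemma clipE c x : clip x c = vscale (clip_factor c x) x.
Proof.
rewrite /clip /clip_factor; case: eqP => // x0.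
by apply: eq_from_tnth => i; rewrite !tnth_vec normv0_tnth// mulr0.
Qed.

Lemma clip_factor_ge0 c x : 0 <= c -> 0 <= clip_factor c x.
Proof.
rewrite /clip_factor; case: eqP => // _ c0.
by rewrite le_min ler01 divr_ge0// normv_ge0.
Qed.

Lemma clip_factor_le1 c x : clip_factor c x <= 1.
Proof. by rewrite /clip_factor; case: eqP => // _; rewrite ge_min lexx. Qed.

Lemma clip_factor_normv_le c x : 0 <= c -> clip_factor c x * normv x <= c.
Proof.
rewrite /clip_factor; case: eqP => [->|/eqP x0] c0; first by rewrite mulr0.
have xpos : 0 < normv x by rewrite lt_neqAle eq_sym x0 normv_ge0.
by rewrite -ler_pdivlMr// ge_min lexx orbT.
Qed.

Lemma normv_clip_le c v x : 0 <= c -> `|dotv v (clip x c)| <= normv v * c.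
Proof.
move=> c0; rewrite clipE dotvZr normrM ger0_norm; last exact: clip_factor_ge0.
apply: (@le_trans _ _ (clip_factor c x * (normv v * normv x))).
  by rewrite ler_wpM2l ?ler_dotv// clip_factor_ge0.
by rewrite mulrCA ler_wpM2l ?normv_ge0// clip_factor_normv_le.
Qed.

(* Rotation by pi about the line spanned by u; for u = 0 the junk value
   0^-1 = 0 makes it the point reflection at the origin. *)
Definition axial_refl u y := vsub (vscale (2 * (dotv y u / dotv u u)) u) y.

Lemma dotv_axial_refl u y z : dotv (axial_refl u y) z =
  2 * (dotv y u / dotv u u) * dotv u z - dotv y z.
Proof. by rewrite !dotvE. Qed.

(** True for b = 0 as well, thanks to 0^-1 = 0; [dotv_axial_refl2] can thus avoid splitting on u =
    0. *)
Lemma mulf_divV (a b : R) : a / b * (a / b * b) = a * (a / b).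
Proof.
have [->|b0] := eqVneq b 0; first by rewrite invr0 !mulr0.
by rewrite divfK// mulrC.
Qed.

Lemma axial_refl_axis u y : dotv (axial_refl u y) u / dotv u u = dotv y u / dotv u u.
Proof.
rewrite dotv_axial_refl; have [->|b0] := eqVneq (dotv u u) 0.
  by rewrite invr0 !mulr0.
by field.
Qed.

Lemma axial_reflK u : involutive (axial_refl u).
Proof.
move=> y; apply: eq_from_tnth => i; rewrite {1}/axial_refl axial_refl_axis.
by rewrite !tnth_vec; ring.
Qed.

Lemma axial_reflD u x y :
  axial_refl u (vadd x y) = vadd (axial_refl u x) (axial_refl u y).
Proof. by apply: eq_from_tnth => i; rewrite !tnth_vec !dotvE; ring. Qed.

Lemma dotv_axial_refl2 u y : dotv (axial_refl u y) (axial_refl u y) = dotv y y.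
Proof.
rewrite {2}/axial_refl dotvBr dotvZr !dotv_axial_refl (dotvC u y).
have := mulf_divV (dotv y u) (dotv u u); set q := _ / _ => h.
transitivity (dotv y y + 4 * (q * (q * dotv u u) - dotv y u * q)); first ring.
by rewrite h; ring.
Qed.

Lemma normv_axial_refl u y : normv (axial_refl u y) = normv y.
Proof. by rewrite /normv dotv_axial_refl2. Qed.

(** With additivity, this shows that the rotation keeps the distance to u, hence any density radial
    about u. *)
Lemma axial_refl_axis_fixed u : axial_refl u u = u.
Proof.
apply: eq_from_tnth => i; rewrite !tnth_vec.
have [u0|b0] := eqVneq (dotv u u) 0.
  have := sqr_tnth_le u i; rewrite u0 => h.
  have /eqP -> : tnth u i == 0 by rewrite -sqrf_eq0 eq_le h sqr_ge0.
  by rewrite mulr0 subr0.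
by rewrite divff//; ring.
Qed.

Lemma axial_reflB u x y :
  axial_refl u (vsub x y) = vsub (axial_refl u x) (axial_refl u y).
Proof. by apply: eq_from_tnth => i; rewrite !tnth_vec !dotvE; ring. Qed.

Lemma normv_axial_refl_center u y :
  normv (vsub (axial_refl u y) u) = normv (vsub y u).
Proof. by rewrite -{2}(axial_refl_axis_fixed u) -axial_reflB normv_axial_refl. Qed.

Definition point_refl u y := vsub (vscale 2 u) y.

Lemma normv_point_refl_center u y :
  normv (vsub (point_refl u y) u) = normv (vsub y u).
Proof. by rewrite /normv !dotvE (dotvC u y); congr Num.sqrt; ring. Qed.

(** A point and its rotated image have equal norms, so equal clip factors; their midpoint is the
    projection of y on the line of u. *)
Lemma half_axial_clip c v u y :
  (dotv v (clip y c) + dotv v (clip (axial_refl u y) c)) / 2 =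
  clip_factor c y * (dotv y u / dotv u u) * dotv v u.
Proof.
have kE : clip_factor c (axial_refl u y) = clip_factor c y.
  by rewrite /clip_factor normv_axial_refl.
rewrite !clipE kE !dotvZr (dotvC v (axial_refl _ _)) dotv_axial_refl.
by rewrite (dotvC u v) (dotvC y v); set q := _ / dotv u u; field.
Qed.

(** Only <z, u> < 0 is critical, for z = 2u - y. Then y makes at least as large a cosine with u as z
    does with -u ([key]), and <y, u> >= -<z, u>. The first fact settles the case where y is
    shortened to length c, the second the case where y is left alone. *)
Lemma clip_pair_far c u y : 0 <= c -> dotv u u <= dotv y u ->
  0 <= clip_factor c y * dotv y u +
       clip_factor c (point_refl u y) * dotv (point_refl u y) u.
Proof.
move=> c0; set s := dotv y u; set z := point_refl u y; set U := dotv u u => Us.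
have U0 : 0 <= U by exact: dotv_ge0.
have s0 : 0 <= s by exact: le_trans Us.
set s' := dotv z u.
have ss' : s' = 2 * U - s by rewrite /s' !dotvE.
have ky := clip_factor_ge0 c y c0; have kz := clip_factor_ge0 c z c0.
have [s'0|s'0] := leP 0 s'; first by rewrite addr_ge0 ?mulr_ge0.
have NN : normv y ^+ 2 = normv z ^+ 2 + 4 * (s - U).
  by rewrite !sqr_normv /z /point_refl !dotvE (dotvC u y) -/s -/U; ring.
have cs : s' ^+ 2 <= normv z ^+ 2 * U by rewrite sqr_normv; exact: sqr_dotv_le.
have zpos : 0 < normv z.
  rewrite lt_neqAle normv_ge0 andbT eq_sym; apply/eqP => z0.
  move: cs; rewrite z0 expr0n/= mul0r => cs.
  have /eqP : s' == 0 by rewrite -sqrf_eq0 eq_le cs sqr_ge0.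
  by move=> e; rewrite e ltxx in s'0.
have ypos : 0 < normv y.
  rewrite lt_neqAle normv_ge0 andbT eq_sym -sqrf_eq0 NN; apply/eqP => e.
  have : 0 < normv z ^+ 2 by rewrite exprn_gt0.
  by have := Us; lra.
have key : - s' * normv y <= s * normv z.
  rewrite -(@ler_pXn2r _ 2)// ?nnegrE; last 2 first.
  - by rewrite mulr_ge0 ?normv_ge0// oppr_ge0 ltW.
  - by rewrite mulr_ge0 ?normv_ge0.
  rewrite !exprMn sqrrN NN -subr_ge0.
  (* Since s + s' = 2U, the difference of squares factors into 4 (s - U) and the Cauchy-Schwarz
     defect of z and u. *)
  have -> : s ^+ 2 * normv z ^+ 2 - s' ^+ 2 * (normv z ^+ 2 + 4 * (s - U)) =
     4 * (s - U) * (normv z ^+ 2 * U - s' ^+ 2) by rewrite ss'; ring.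
  by rewrite mulr_ge0 ?subr_ge0// mulr_ge0// subr_ge0.
suff : clip_factor c z * (- s') <= clip_factor c y * s by lra.
rewrite {2}/clip_factor (negbTE (lt0r_neq0 ypos)).
have [c1|c1] := leP 1 (c / normv y).
  rewrite mul1r (@le_trans _ _ (- s'))//; last by lra.
  by rewrite ler_piMl ?clip_factor_le1// oppr_ge0 ltW.
rewrite mulrAC ler_pdivlMr// -mulrA.
apply: (@le_trans _ _ (clip_factor c z * (s * normv z))).
  by rewrite ler_wpM2l.
by rewrite mulrCA [leRHS]mulrC ler_wpM2l// clip_factor_normv_le// ltW.
Qed.

Lemma point_reflK u : involutive (point_refl u).
Proof. by move=> y; apply: eq_from_tnth => i; rewrite !tnth_vec; ring. Qed.

(** The claim is symmetric in y and its reflection, and their products with u sum to 2 |u|^2, so one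
    of them satisfies the hypothesis of [clip_pair_far]. *)
Lemma clip_pair_ge0 c u y : 0 <= c ->
  0 <= clip_factor c y * dotv y u +
       clip_factor c (point_refl u y) * dotv (point_refl u y) u.
Proof.
move=> c0; have [|h] := leP (dotv u u) (dotv y u); first exact: clip_pair_far.
have := @clip_pair_far c u (point_refl u y) c0; rewrite point_reflK addrC; apply.
by rewrite !dotvE; lra.
Qed.

(** By the triangle inequality |y| <= |u| + c/4. This is at most c if |u| <= 3c/4, and at most
    4|u|/3 otherwise. *)
Lemma clip_factor_near c u y : 0 < c -> normv (vsub y u) < c / 4 ->
  Num.min (normv u) (3 / 4 * c) / normv u <= clip_factor c y.
Proof.
move=> c0 yu; have [u0|u0] := eqVneq (normv u) 0.
  by rewrite u0 invr0 mulr0 clip_factor_ge0// ltW.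
have upos : 0 < normv u by rewrite lt_neqAle eq_sym u0 normv_ge0.
have tri := ler_normv_sub y u.
rewrite ler_pdivrMr// /clip_factor.
case: eqP => [_|/eqP y0]; first by rewrite mul1r ge_min lexx.
have ypos : 0 < normv y by rewrite lt_neqAle eq_sym y0 normv_ge0.
have [_|_] := leP 1 (c / normv y); first by rewrite mul1r ge_min lexx.
rewrite [leRHS]mulrAC ler_pdivlMr//; have [h|h] := leP (normv u) (3 / 4 * c).
  by rewrite mulrC ler_wpM2r ?normv_ge0//; lra.
have yu3 : 3 / 4 * normv y <= normv u by lra.
by rewrite mulrAC mulrC ler_wpM2l// ltW.
Qed.

(** The left side is mu (<y, u> + <z, u>), so the lower bound mu on both clip factors suffices once
    both products are nonnegative. *)
Lemma clip_pair_near c u y : 0 < c -> normv (vsub y u) < c / 4 ->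
  2 * (Num.min (normv u) (3 / 4 * c) / normv u * dotv u u) <=
  clip_factor c y * dotv y u +
  clip_factor c (point_refl u y) * dotv (point_refl u y) u.
Proof.
move=> c0 yu; set mu := _ / normv u; set z := point_refl u y.
have zu : normv (vsub z u) < c / 4 by rewrite normv_point_refl_center.
have ky := @clip_factor_near c u y c0 yu; have kz := @clip_factor_near c u z c0 zu.
have zE : dotv z u = 2 * dotv u u - dotv y u by rewrite !dotvE.
have -> : 2 * (mu * dotv u u) = mu * dotv y u + mu * dotv z u by rewrite zE; ring.
(* For small u the products may be negative, but both factors are exactly 1 (or u = 0). For large u
   the radius c/4 is below |u|, which forces the products to be nonnegative. *)
have [h|h] := leP (normv u) (3 / 4 * c).
  have [u0|u0] := eqVneq (normv u) 0.
    have uu : dotv u u = 0 by rewrite -sqr_normv u0 expr0n.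
    have xu0 x : dotv x u = 0 by rewrite dotvC dotv_eq0.
    by rewrite !xu0 !mulr0.
  have mu1 : mu = 1 by rewrite /mu (min_l h) divff.
  have k1 x : mu <= clip_factor c x -> clip_factor c x = 1.
    by rewrite mu1 => hx; apply/eqP; rewrite eq_le hx clip_factor_le1.
  by rewrite (k1 y ky) (k1 z kz) mu1.
have pos x : normv (vsub x u) < c / 4 -> 0 <= dotv x u.
  move=> xu; have : `|dotv (vsub x u) u| <= normv u * normv u.
    apply: (le_trans (ler_dotv _ _)); rewrite ler_wpM2r ?normv_ge0//; lra.
  by rewrite ler_norml -expr2 sqr_normv dotvBl => /andP[]; lra.
by rewrite lerD// ler_wpM2r// pos.
Qed.

End clipping.

(** * Boxes generate the Borel sets; measurability of vector operations *)

Section measurability.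
Import numFieldNormedType.Exports.
Context {R : realType} {d : nat}.

Definition boxes : set (set (d.-tuple R)) := [set box a b | a in setT & b in setT].

Lemma tnth_preimage_itvcy (i : 'I_d) (t : R) :
  [set x : d.-tuple R | t <= tnth x i] =
  \bigcup_n box [tuple if j == i then t else - n%:R | j < d] [tuple n%:R | j < d].
Proof.
apply/seteqP; split => x /=.
  (* An integer above the sum of all |x_j| bounds every coordinate at once. *)
  move=> tx; exists (Num.trunc (\sum_(j < d) `|tnth x j|)).+1 => // j.
  have : `|tnth x j| <= (Num.trunc (\sum_(j < d) `|tnth x j|)).+1%:R.
    apply: ltW; apply: le_lt_trans (truncnS_gt _).
    by rewrite (bigD1 j)//= lerDl sumr_ge0.
  rewrite ler_norml !tnth_mktuple => /andP[h1 h2]; rewrite h2 andbT.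
  by case: eqP => // ->.
by move=> [n _ /(_ i)]; rewrite !tnth_mktuple eqxx => /andP[].
Qed.

Lemma measurable_box (a b : d.-tuple R) : measurable (box a b).
Proof.
rewrite (_ : box a b = \big[setI/setT]_(i < d)
   ((@tnth d R)^~ i @^-1` [set` `[tnth a i, tnth b i]%R])).
  apply: bigsetI_measurable => i _; rewrite -[X in measurable X]setTI.
  by apply: measurable_tnth.
rewrite -bigcap_seq; apply/seteqP; split => x /= h i.
  by move=> _ /=; rewrite in_itv/=; exact: h.
by have /= := h i; rewrite in_itv/= mem_index_enum; apply.
Qed.

(** Rays [t, +oo) generate the Borel sets of the line, and their preimages under a coordinate are
    countable unions of boxes. This makes boxes a generating pi-system for measure uniqueness. *)
Lemma measurable_boxesE : @measurable _ (d.-tuple R) = <<s boxes >>.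
Proof.
apply/seteqP; split => A; last first.
  apply: smallest_sub => [|_ [a _ [b _ <-]]]; first exact: sigma_algebra_measurable.
  exact: measurable_box.
apply: smallest_sub; first exact: smallest_sigma_algebra.
rewrite -bigcup_seq => B [i /= _ [C mC <-{B}]].
have {}mC : <<s @RGenCInfty.G R >> C.
  exact: eq_ind _ (fun S => S C) mC _ (RGenCInfty.measurableE R).
suff sub : <<s preimage_set_system [set: d.-tuple R] ((@tnth d R)^~ i)
      (@RGenCInfty.G R) >>
    `<=` <<s boxes >> by apply: sub; rewrite g_sigma_preimageE; exists C.
apply: smallest_sub; first exact: smallest_sigma_algebra.
move=> _ [_ [t ->] <-].
rewrite setTI (_ : _ @^-1` _ = [set x : d.-tuple R | t <= tnth x i]); last first.
  by apply/seteqP; split => x /=; rewrite in_itv/= andbT.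
rewrite tnth_preimage_itvcy; apply: sigma_algebra_bigcup => n.
by apply: sub_sigma_algebra; eexists => //; eexists.
Qed.

Lemma boxes_setI_closed : setI_closed boxes.
Proof.
move=> _ _ [a _ [b _ <-]] [a' _ [b' _ <-]].
exists [tuple Num.max (tnth a i) (tnth a' i) | i < d] => //.
exists [tuple Num.min (tnth b i) (tnth b' i) | i < d] => //.
apply/seteqP; split => x /=.
  move=> h; split=> i; have := h i; rewrite !tnth_mktuple ge_max le_min;
  by move=> /andP[/andP[h1 h2] /andP[h3 h4]]; apply/andP.
move=> [h h'] i; rewrite !tnth_mktuple ge_max le_min.
by have /andP[-> ->] := h i; have /andP[-> ->] := h' i.
Qed.

Definition cube (n : nat) : set (d.-tuple R) :=
  box [tuple - n%:R | i < d] [tuple n%:R | i < d].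

Lemma bigcup_cube : \bigcup_n cube n = setT.
Proof.
apply/seteqP; split => // x _.
exists (Num.trunc (\sum_(j < d) `|tnth x j|)).+1 => // j.
rewrite !tnth_mktuple -ler_norml; apply: ltW; apply: le_lt_trans (truncnS_gt _).
by rewrite (bigD1 j)//= lerDl sumr_ge0.
Qed.

Lemma measurable_tuple (d' : measure_display) (T : measurableType d')
    (f : T -> d.-tuple R) :
  (forall i, measurable_fun setT (fun x => tnth (f x) i)) -> measurable_fun setT f.
Proof. by move=> h; apply/measurable_fun_tnthP. Qed.

Lemma measurable_coord (d' : measure_display) (T : measurableType d')
    (f : T -> d.-tuple R) i :
  measurable_fun setT f -> measurable_fun setT (fun x => tnth (f x) i).
Proof. by move=> /measurable_fun_tnthP; apply. Qed.

Lemma measurable_dotv (d' : measure_display) (T : measurableType d')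
    (f g : T -> d.-tuple R) :
  measurable_fun setT f -> measurable_fun setT g ->
  measurable_fun setT (fun x => dotv (f x) (g x)).
Proof.
move=> mf mg; apply: measurable_sum => i.
by apply: measurable_funM; exact: measurable_coord.
Qed.

Lemma measurable_vadd (d' : measure_display) (T : measurableType d')
    (f g : T -> d.-tuple R) :
  measurable_fun setT f -> measurable_fun setT g ->
  measurable_fun setT (fun x => vadd (f x) (g x)).
Proof.
move=> mf mg; apply: measurable_tuple => i; under eq_fun do rewrite tnth_vadd.
by apply: measurable_funD; exact: measurable_coord.
Qed.

Lemma measurable_vsub (d' : measure_display) (T : measurableType d')
    (f g : T -> d.-tuple R) :
  measurable_fun setT f -> measurable_fun setT g ->
  measurable_fun setT (fun x => vsub (f x) (g x)).
Proof.
move=> mf mg; apply: measurable_tuple => i; under eq_fun do rewrite tnth_vsub.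
by apply: measurable_funB; exact: measurable_coord.
Qed.

Lemma measurable_vscale (d' : measure_display) (T : measurableType d')
    (a : T -> R) (f : T -> d.-tuple R) :
  measurable_fun setT a -> measurable_fun setT f ->
  measurable_fun setT (fun x => vscale (a x) (f x)).
Proof.
move=> ma mf; apply: measurable_tuple => i; under eq_fun do rewrite tnth_vscale.
by apply: measurable_funM => //; exact: measurable_coord.
Qed.

End measurability.

(** * Measure-preserving maps and change of variables *)

Definition preserves {dd : measure_display} {T : measurableType dd} {R : realType}
    (mu : {measure set T -> \bar R}) (f : T -> T) : Prop :=
  measurable_fun setT f /\ forall A, measurable A -> mu (f @^-1` A) = mu A.

Section preserves.
Context {dd : measure_display} {T : measurableType dd} {R : realType}.
Context (mu : {measure set T -> \bar R}).
Local Open Scope ereal_scope.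

Lemma preserves_comp (f g : T -> T) :
  preserves mu f -> preserves mu g -> preserves mu (f \o g).
Proof.
move=> [mf pf] [mg pg]; split; first exact: measurableT_comp.
move=> A mA; rewrite comp_preimage pg ?pf// -[X in measurable X]setTI.
exact: mf.
Qed.

Lemma preserves_ge0_integral (f : T -> T) (h : T -> \bar R) :
  preserves mu f -> measurable_fun setT h -> (forall x, 0 <= h x) ->
  \int[mu]_x h (f x) = \int[mu]_x h x.
Proof.
move=> [mf pf] mh h0.
have := ge0_integral_pushforward mf mu measurableT mh (fun x _ => h0 x).
rewrite preimage_setT => <-.
by apply: eq_measure_integral => A mA _; exact: pf.
Qed.

Lemma preserves_integral (f : T -> T) (h : T -> \bar R) :
  preserves mu f -> mu.-integrable setT h ->
  mu.-integrable setT (h \o f) /\ \int[mu]_x h (f x) = \int[mu]_x h x.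
Proof.
move=> pf ih; have [mf pf2] := pf.
have mh : measurable_fun setT h by apply: measurable_int ih.
have ihf : mu.-integrable setT (h \o f).
  apply/integrableP; split; first exact: measurableT_comp mf.
  have := @preserves_ge0_integral f (abse \o h) pf _ (fun x => abse_ge0 _).
  rewrite /= => ->; last exact: measurableT_comp.
  by move/integrableP : ih => [].
split=> //; have := integral_pushforward mf mh ihf measurableT.
rewrite preimage_setT => <-.
by apply: eq_measure_integral => A mA _; exact: pf2.
Qed.

End preserves.

(** * Tonelli's theorem from sigma-finiteness hypotheses *)

Section tonelli_sigma_finite.
Context {d1 d2 : measure_display} {T1 : measurableType d1}
    {T2 : measurableType d2} {R : realType} (m1 : {measure set T1 -> \bar R})
    (m2 : {measure set T2 -> \bar R})
    (s1 : sigma_finite setT m1) (s2 : sigma_finite setT m2).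
(** Aliases of the measures, to which the hypotheses [s1] and [s2] attach the sigma-finite
    structure. *)
Let n1 : set T1 -> \bar R := m1.
Let n2 : set T2 -> \bar R := m2.
HB.instance Definition _ := Measure.on n1.
HB.instance Definition _ := Measure_isSigmaFinite.Build _ _ _ n1 s1.
HB.instance Definition _ := Measure.on n2.
HB.instance Definition _ := Measure_isSigmaFinite.Build _ _ _ n2 s2.
Lemma tonelli_sigma_finite (f : T1 * T2 -> \bar R) :
  measurable_fun setT f -> (forall z, 0 <= f z)%E ->
  (\int[m1]_x \int[m2]_y f (x, y) = \int[m2]_y \int[m1]_x f (x, y))%E.
Proof.
move=> mf f0.
exact: (@fubini_tonelli _ _ _ _ R n1 n2 f mf f0).
Qed.
End tonelli_sigma_finite.

(** * Invariance of Lebesgue measure under translations and linear isometries *)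

Section lebesgue.
Context {R : realType} {d : nat}.
Context (lam : {measure set (d.-tuple R) -> \bar R}).
Context (lamE : is_lebesgue_measure lam).

Lemma lebesgue_box_ltoo (a b : d.-tuple R) : (lam (box a b) < +oo)%E.
Proof.
have [ab|] := pselect (forall i, tnth a i <= tnth b i); first by rewrite lamE// ltry.
move=> /existsNP[i /negP ab]; rewrite (_ : box a b = set0) ?measure0//.
apply/seteqP; split => // x /(_ i) /andP[ax xb].
by move: ab; rewrite (le_trans ax xb).
Qed.

(** The translated measure and [lam] agree on boxes, a generating pi-system, and are finite on the
    cubes exhausting the space. *)
Lemma preserves_vadd (t : d.-tuple R) : preserves lam (fun x => vadd x t).
Proof.
have mf : measurable_fun setT (fun x : d.-tuple R => vadd x t).
  by apply: measurable_vadd => //; exact: measurable_cst.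
split => // A mA.
have preE (a b : d.-tuple R) :
    lam ((fun x => vadd x t) @^-1` box a b) = lam (box (vsub a t) (vsub b t)).
  congr (lam _); apply/seteqP.
  by split => x /= h i; have := h i; rewrite !tnth_vec; lra.
apply: (measure_unique boxes cube _ boxes_setI_closed _ bigcup_cube
  (pushforward lam (fun x => vadd x t)) lam) => //.
- exact: measurable_boxesE.
- by move=> n; eexists => //; eexists.
- move=> _ [a _ [b _ <-]]. apply: (etrans (preE a b)).
  have [ab|] := pselect (forall i, tnth a i <= tnth b i).
    rewrite !lamE//; last by move=> i; rewrite !tnth_vec lerD2r.
    by congr EFin; apply: eq_bigr => i _; rewrite !tnth_vec; ring.
  (* [lamE] covers only boxes with ordered corners; any other box is empty, and so is its
     translate. *)
  move=> /existsNP[i /negP ab].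
  have empty (u v : d.-tuple R) : ~~ (tnth u i <= tnth v i) -> box u v = set0.
    move=> uv; apply/seteqP; split => // x /(_ i) /andP[ax xb].
    by move: uv; rewrite (le_trans ax xb).
  by rewrite !empty// !tnth_vec lerD2r.
- by move=> n; rewrite [X in (X < _)%E](preE _ _) lebesgue_box_ltoo.
Qed.

Lemma sigma_finite_lebesgue : sigma_finite setT lam.
Proof.
exists cube; first by rewrite bigcup_cube.
by move=> n; split; [exact: measurable_box|exact: lebesgue_box_ltoo].
Qed.

(** The ball of radius sqrt d contains the cube [-1, 1]^d, so it has positive measure for every d.
    It serves as the symmetric, isometry-invariant reference set. *)
Definition cball : set (d.-tuple R) := [set x | dotv x x <= d%:R].

Lemma measurable_cball : measurable cball.
Proof.
rewrite -[X in measurable X]setTI; apply: measurable_fun_ler => //.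
by apply: measurable_dotv.
Qed.

Lemma lebesgue_cball_gt0 : (0 < lam cball)%E.
Proof.
apply: (@lt_le_trans _ _ (lam (cube 1))).
  rewrite lamE => [|i]; rewrite ?lte_fin; last by rewrite !tnth_mktuple; lra.
  by apply: prodr_gt0 => i _; rewrite !tnth_mktuple; lra.
apply: le_measure; rewrite ?inE; [exact: measurable_box|exact: measurable_cball|].
move=> x /= h; apply: (@le_trans _ _ (\sum_(i < d) 1)); last first.
  by rewrite sumr_const card_ord.
apply: ler_sum => i _; have := h i; rewrite !tnth_mktuple; nra.
Qed.

Lemma lebesgue_cball_ltoo : (lam cball < +oo)%E.
Proof.
apply: le_lt_trans (lebesgue_box_ltoo [tuple - d.+1%:R | i < d]
  [tuple d.+1%:R | i < d]).
apply: le_measure; rewrite ?inE; [exact: measurable_cball|exact: measurable_box|].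
move=> x /= h i; rewrite !tnth_mktuple -ler_norml.
rewrite -(@ler_pXn2r _ 2)// ?nnegrE// real_normK ?num_real//.
apply: (le_trans (sqr_tnth_le x i)); apply: (le_trans h).
by rewrite -natrX ler_nat (leq_trans (leqnSn d))// -mulnn leq_pmulr.
Qed.

(* Tonelli applied to 1_A (x + y) 1_B (y), translating x for fixed y on one side
   and y for fixed x on the other. *)
Lemma translation_invariant_unique (nu : {measure set (d.-tuple R) -> \bar R})
    (A B : set (d.-tuple R)) :
  sigma_finite setT nu -> (forall t, preserves nu (fun x => vadd x t)) ->
  measurable A -> measurable B -> (forall x, B x -> B (vscale (-1) x)) ->
  (nu A * lam B = lam A * nu B)%E.
Proof.
move=> snu pnu mA mB symB.
have mindic d' (T : measurableType d') (f : T -> d.-tuple R) C : measurable C ->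
    measurable_fun setT f -> measurable_fun setT (fun z => \1_C (f z) : R).
  by move=> mC mf; exact: measurableT_comp (measurable_indic mC) mf.
pose f1 z : \bar R := (\1_A (vadd z.1 z.2) * \1_B z.2)%:E.
pose f2 z : \bar R := (\1_A z.2 * \1_B (vsub z.2 z.1))%:E.
have f1_ge0 z : (0 <= f1 z)%E by rewrite lee_fin mulr_ge0.
have f2_ge0 z : (0 <= f2 z)%E by rewrite lee_fin mulr_ge0.
have mf1 : measurable_fun setT f1.
  apply/measurable_EFinP; apply: measurable_funM;
    apply: (mindic _ (d.-tuple R * d.-tuple R)%type) => //.
  exact: measurable_vadd.
have mf2 : measurable_fun setT f2.
  apply/measurable_EFinP; apply: measurable_funM;
    apply: (mindic _ (d.-tuple R * d.-tuple R)%type) => //.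
  exact: measurable_vsub.
have nu_ge0 C : (0 <= nu C)%E by exact: measure_ge0.
have mI (C : set (d.-tuple R)) : measurable C ->
    measurable_fun setT (fun x => (\1_C x : R)%:E).
  by move=> mC; apply/measurable_EFinP; exact: measurable_indic.
have intI (C : set (d.-tuple R)) (mu : {measure set (d.-tuple R) -> \bar R}) :
    measurable C -> (\int[mu]_x (\1_C x : R)%:E = mu C)%E.
  by move=> mC; rewrite integral_indic// setIT.
transitivity (\int[lam]_y \int[nu]_x f1 (x, y))%E.
  transitivity (\int[lam]_y ((\1_B y : R)%:E * nu A))%E.
    rewrite ge0_integralZr//; last exact: mI.
    by rewrite intI// muleC.
  apply: eq_integral => y _.
  transitivity (\int[nu]_x ((\1_B y : R)%:E * (\1_A (vadd x y) : R)%:E))%E; last first.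
    by apply: eq_integral => x _; rewrite /f1 /= mulrC EFinM.
  rewrite ge0_integralZl//; last first.
    by apply/measurable_EFinP; apply: mindic => //; exact: (proj1 (pnu y)).
  rewrite (preserves_ge0_integral _ _ (fun x => (\1_A x : R)%:E) (pnu y))//.
    by rewrite intI.
  exact: mI.
rewrite -(tonelli_sigma_finite _ _ snu sigma_finite_lebesgue _ mf1)//.
transitivity (\int[nu]_x \int[lam]_y f2 (x, y))%E.
  apply: eq_integral => x _.
  rewrite -(preserves_ge0_integral _ _ (fun y => f2 (x, y)) (preserves_vadd x))//; last first.
    exact: measurableT_comp.
  apply: eq_integral => y _; rewrite /f1 /f2 /=; congr (\1_A _ * \1_B _)%:E.
    by apply: eq_from_tnth => i; rewrite !tnth_vec addrC.
  by apply: eq_from_tnth => i; rewrite !tnth_vec addrK.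
rewrite (tonelli_sigma_finite _ _ snu sigma_finite_lebesgue _ mf2)//.
transitivity (\int[lam]_y ((\1_A y : R)%:E * nu B))%E; last first.
  by rewrite ge0_integralZr// ?intI//; exact: mI.
apply: eq_integral => y _.
(* Replacing x by x + y turns the argument of 1_B into -x; here the symmetry of B enters. *)
rewrite -(preserves_ge0_integral _ _ (fun x => f2 (x, y)) (pnu y))//; last first.
  exact: measurableT_comp.
rewrite -(intI _ nu mB) -ge0_integralZl//; last exact: mI.
apply: eq_integral => x _; rewrite -EFinM /f2 /=; congr (_ * _)%:E.
have -> : vsub y (vadd x y) = vscale (-1) x.
  by apply: eq_from_tnth => i; rewrite !tnth_vec; ring.
have vNN z : vscale (-1) (vscale (-1) z) = z :> d.-tuple R.
  by apply: eq_from_tnth => i; rewrite !tnth_vec; ring.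
rewrite !indicE; congr (nat_of_bool _)%:R.
by apply/idP/idP => /set_mem h; apply/mem_set; [rewrite -(vNN x)|]; exact: symB.
Qed.

(** The image of [lam] under H is translation invariant because H x + t = H (x + H t). It is
    therefore proportional to [lam], and H fixes [cball], so the constant is 1. *)
Lemma preserves_isometry (H : d.-tuple R -> d.-tuple R) :
  measurable_fun setT H -> involutive H ->
  (forall x y, H (vadd x y) = vadd (H x) (H y)) ->
  (forall x, dotv (H x) (H x) = dotv x x) -> preserves lam H.
Proof.
move=> mH HK HD Hiso; split => // A mA.
have cH : H @^-1` cball = cball by apply/seteqP; split => x; rewrite /cball/= Hiso.
have snu : sigma_finite setT (pushforward lam H).
  have [F FT Foo] := sigma_finite_lebesgue.
  exists (fun n => H @^-1` F n).
    by rewrite -preimage_bigcup -FT.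
  move=> n; have [mF Flt] := Foo n; split.
    by rewrite -[X in measurable X]setTI; exact: mH.
  have HH : H @^-1` (H @^-1` F n) = F n by apply/seteqP; split => x /=; rewrite HK.
  by rewrite -HH in Flt.
have h : (lam (H @^-1` A) * lam cball = lam A * lam (H @^-1` cball))%E.
  apply: (@translation_invariant_unique (pushforward lam H) A cball snu _ mA
    measurable_cball _) => [t|x]; last first.
    by rewrite /cball/= dotvZl dotvZr !mulN1r opprK.
  split=> [|C mC]; first exact: (proj1 (preserves_vadd t)).
  have mHC : measurable (H @^-1` C) by rewrite -[X in measurable X]setTI; exact: mH.
  have HtC : lam ((fun x => vadd x (H t)) @^-1` (H @^-1` C)) = lam (H @^-1` C).
    exact: (proj2 (preserves_vadd (H t))).
  apply: etrans HtC.
  by congr (lam _); apply/seteqP; split => x /=; rewrite HD HK.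
rewrite cH in h.
have := h; rewrite (_ : lam cball = (fine (lam cball))%:E); last first.
  by rewrite fineK// ge0_fin_numE// lebesgue_cball_ltoo.
have b0 : (0 < fine (lam cball)).
  by rewrite fine_gt0// lebesgue_cball_gt0 lebesgue_cball_ltoo.
(* Cancelling is legitimate in the extended reals as [lam cball] is positive and finite. *)
move=> /(congr1 (fun z => z * ((fine (lam cball))^-1)%:E)%E).
by rewrite -!muleA -!EFinM divff ?gt_eqF// !mule1.
Qed.

End lebesgue.

(** * Mean of the clipped vector under a single radial density *)

Section clipped_expectation.
Context {R : realType} {d : nat}.
Context (lam : {measure set (d.-tuple R) -> \bar R}).
Implicit Types (F p : d.-tuple R -> R) (T : d.-tuple R -> d.-tuple R).

(** F and its composite with T have the same mean under p, so either may be replaced by their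
    average. *)
Lemma integral_symmetrize F p T : preserves lam T -> (forall y, p (T y) = p y) ->
  lam.-integrable setT (fun y => (F y * p y)%:E) ->
  lam.-integrable setT (fun y => ((F y + F (T y)) / 2 * p y)%:E) /\
  (\int[lam]_y ((F y + F (T y)) / 2 * p y)%:E = \int[lam]_y (F y * p y)%:E)%E.
Proof.
move=> pT pE iF; have [iFT eFT] := preserves_integral _ _ _ pT iF.
have sE : (fun y => ((F y + F (T y)) / 2 * p y)%:E) =
    (fun y => (2^-1)%:E * (F y * p y)%:E + (2^-1)%:E * (F (T y) * p (T y))%:E)%E.
  by apply/funext => y; rewrite -!EFinM -EFinD pE; congr EFin; lra.
have i1 := integrableZl measurableT 2^-1 iF.
have i2 := integrableZl measurableT 2^-1 iFT.
rewrite sE; split; first exact: integrableD i1 i2.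
rewrite (integralD measurableT i1 i2) !integralZl//.
rewrite [X in (_ + _ * X)%E]eFT -(@fineK _ (integral _ _ _)); last exact: integrable_fin_num.
by rewrite -!EFinM -EFinD; congr EFin; lra.
Qed.

Lemma measurable_normv (dd : measure_display) (X : measurableType dd)
    (f : X -> d.-tuple R) :
  measurable_fun setT f -> measurable_fun setT (fun x => normv (f x)).
Proof.
move=> mf; apply: (measurableT_comp (f := @Num.sqrt R)).
  by apply: continuous_measurable_fun; exact: sqrt_continuous.
exact: measurable_dotv.
Qed.

Lemma measurable_clip_factor (c : R) : measurable_fun setT (@clip_factor R d c).
Proof.
have mn : measurable_fun setT (@normv R d) by apply: measurable_normv.
rewrite /clip_factor; apply: measurable_fun_ifT => //.
  by apply: measurable_fun_eqr.
apply: measurable_minr => //; apply: measurable_funM => //.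
have -> : (fun x : d.-tuple R => (normv x)^-1) = (fun x => powR (normv x) (-1)).
  by apply/funext => x; rewrite powR_inv1// normv_ge0.
apply: (measurableT_comp (f := fun a : R => powR a (-1))) => //; exact: measurable_powR.
Qed.

Lemma measurable_clip (c : R) : measurable_fun setT (fun x : d.-tuple R => clip x c).
Proof.
under eq_fun do rewrite clipE.
by apply: measurable_vscale => //; exact: measurable_clip_factor.
Qed.

Lemma integrable_clip (c : R) v p : 0 < c -> is_prob_density lam p ->
  lam.-integrable setT (fun y => (dotv v (clip y c) * p y)%:E).
Proof.
move=> c0 [mp [p0 p1]].
have ip : lam.-integrable setT (fun y => (p y)%:E).
  apply/integrableP; split; first exact/measurable_EFinP.
  rewrite (_ : (integral _ _ _) = 1%E) ?ltry// -p1.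
  by apply: eq_integral => y _; rewrite gee0_abs// lee_fin.
apply: le_integrable (integrableZl measurableT (normv v * c) ip) => //.
  apply/measurable_EFinP; apply: measurable_funM => //.
  by apply: measurable_dotv => //; exact: measurable_clip.
move=> y _ /=; rewrite lee_fin !normrM ler_wpM2r//.
by rewrite (le_trans (normv_clip_le _ _ _ (ltW c0)))// -normrM ler_norm.
Qed.

(** Rewrites the target weight so that a / |u| appears, the quantity that bounds the clip factors
    from below; the conventions for zero vectors agree on both sides. *)
Lemma cosv_weightE (a : R) (v u : d.-tuple R) :
  normv v * (a * cosv v u) = dotv v u * (a / normv u).
Proof.
rewrite /cosv; have [v0|v0]/= := eqVneq (normv v) 0.
  by rewrite v0 mul0r dotv_eq0 ?mul0r// -sqr_normv v0 expr0n.
have [->|u0] := eqVneq (normv u) 0; first by rewrite invr0 !mulr0.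
by field; rewrite v0 u0.
Qed.

Context (lamE : is_lebesgue_measure lam).

Lemma preserves_axial_refl u : preserves lam (axial_refl u).
Proof.
apply: preserves_isometry => //.
- apply: measurable_vsub => //; apply: measurable_vscale => //.
  do 2 apply: measurable_funM => //.
  exact: measurable_dotv.
- exact: axial_reflK.
- exact: axial_reflD.
- exact: dotv_axial_refl2.
Qed.

Lemma preserves_point_refl u : preserves lam (point_refl u).
Proof.
rewrite (_ : point_refl u = (fun x => vadd x (vscale 2 u)) \o vscale (-1)); last first.
  by apply/funext => x; apply: eq_from_tnth => i; rewrite /= !tnth_vec; lra.
apply: preserves_comp; first exact: preserves_vadd.
apply: preserves_isometry => // [|x|x y|x].
- exact: measurable_vscale.
- by apply: eq_from_tnth => i; rewrite !tnth_vec; lra.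
- by apply: eq_from_tnth => i; rewrite !tnth_vec; lra.
- by rewrite !dotvE; lra.
Qed.

Lemma clipped_expectation_ge (c : R) v u p (phi : R -> R) : 0 < c ->
  is_prob_density lam p -> (forall y, p y = phi (normv (vsub y u))) ->
  0 <= dotv v u ->
  ((normv v * (Num.min (normv u) (3 / 4 * c) * cosv v u))%:E *
    \int[lam]_(y in [set y | (normv (vsub y u) < c / 4)%R]) (p y)%:E <=
   \int[lam]_y (dotv v (clip y c) * p y)%:E)%E.
Proof.
move=> c0 pd pE vu0; have [mp [p0 p1]] := pd.
set B := [set y | _].
have mB : measurable B.
  rewrite -[X in measurable X]setTI; apply: measurable_fun_ltr => //.
  by apply: measurable_normv; exact: measurable_vsub.
rewrite cosv_weightE; set mu := _ / normv u.
have mu0 : 0 <= mu.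
  by rewrite divr_ge0 ?normv_ge0// le_min normv_ge0/= mulr_ge0// ltW.
pose F y := dotv v (clip y c).
have [|iF1 <-] := integral_symmetrize F p _ (preserves_axial_refl u) _
  (integrable_clip _ v p c0 pd).
  by move=> y; rewrite !pE normv_axial_refl_center.
(* [F1] averages over the rotation; [F2] below averages [F1] over the point reflection. *)
set F1 := (fun y => (F y + F (axial_refl u y)) / 2) in iF1 *.
have [|iF2 <-] := integral_symmetrize F1 p _ (preserves_point_refl u) _ iF1.
  by move=> y; rewrite !pE normv_point_refl_center.
set F2 := (fun y => (F1 y + F1 (point_refl u y)) / 2) in iF2 *.
pose S y := clip_factor c y * dotv y u +
  clip_factor c (point_refl u y) * dotv (point_refl u y) u.
have F2E y : F2 y = dotv v u / dotv u u * (S y / 2).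
  by rewrite /F2 /F1 /F !half_axial_clip /S; set q := (dotv u u)^-1; lra.
have F2_ge0 y : 0 <= F2 y.
  by rewrite F2E !mulr_ge0 ?invr_ge0 ?dotv_ge0// clip_pair_ge0// ltW.
have F2_ge y : B y -> dotv v u * mu <= F2 y.
  move=> By; have [u0|u0] := eqVneq (dotv u u) 0.
    by rewrite F2E dotvC (dotv_eq0 _ _ u0) !mul0r.
  rewrite F2E -mulrA ler_wpM2l// mulrC ler_pdivlMr ?lt_neqAle ?dotv_ge0 1?eq_sym ?u0//.
  by rewrite ler_pdivlMr// mulrC; exact: clip_pair_near.
have mF2p : measurable_fun setT (fun y => (F2 y * p y)%:E) by apply: measurable_int iF2.
have mpE : measurable_fun setT (fun y => (p y)%:E) by exact/measurable_EFinP.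
rewrite -ge0_integralZl//; last 3 first.
- exact: measurable_funTS.
- by move=> y _; rewrite lee_fin.
- by rewrite lee_fin mulr_ge0.
apply: (@le_trans _ _ (\int[lam]_(y in B) (F2 y * p y)%:E)%E).
  apply: ge0_le_integral => //.
  - by move=> y _; rewrite -EFinM lee_fin (mulr_ge0 (mulr_ge0 vu0 mu0)).
  - by apply: measurable_funeM; exact: measurable_funTS.
  - exact: measurable_funTS.
  - by move=> y By; rewrite -EFinM lee_fin ler_wpM2r// F2_ge.
by apply: ge0_subset_integral => // y _; rewrite lee_fin mulr_ge0.
Qed.

End clipped_expectation.

(** * Assembling the mixture from its components *)

Theorem theorem3 (R : realType) (d m : nat)
  (lam : {measure set (d.-tuple R) -> \bar R})
  (c : R) (v : d.-tuple R)
  (u : 'I_m -> d.-tuple R) (w : 'I_m -> R)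
  (p : 'I_m -> d.-tuple R -> R) :
  is_lebesgue_measure lam ->
  0 < c ->
  (forall i, is_prob_density lam (p i)) ->
  (forall i, exists phi : R -> R, forall y, p i y = phi (normv (vsub y (u i)))) ->
  (forall i, 0 <= w i) ->
  \sum_(i < m) w i = 1 ->
  v = \big[vadd/vzero]_(i < m) vscale (w i) (u i) ->
  (forall i, 0 <= dotv (u i) v) ->
  let pmix := fun xi : d.-tuple R => \sum_(i < m) w i * p i (vadd xi v) in
  let Pball := fun i : 'I_m =>
    (\int[lam]_(y in [set y | (normv (vsub y (u i)) < c / 4)%R]) (p i y)%:E)%E in
  let RHS := ((normv v)%:E *
      \sum_(i < m) ((w i * Num.min (normv (u i)) (3 / 4 * c) * cosv v (u i))%:E
                    * Pball i))%E in
  (\int[lam]_xi ((dotv v (clip (vadd v xi) c)) * pmix xi)%:E >= RHS)%E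
  /\ (RHS >= 0)%E.
Proof.
move=> lamE c0 pd prad w0 _ _ uv0 pmix Pball RHS.
have Pball_ge0 i : (0 <= Pball i)%E.
  by apply: integral_ge0 => y _; rewrite lee_fin; have [_ []] := pd i.
have cos_ge0 i : 0 <= cosv v (u i).
  rewrite /cosv; case: ifP => // _.
  by rewrite divr_ge0 ?mulr_ge0 ?normv_ge0// dotvC.
have term_ge0 i : (0 <= (w i * Num.min (normv (u i)) (3 / 4 * c) * cosv v (u i))%:E
    * Pball i)%E.
  by rewrite mule_ge0// lee_fin !mulr_ge0// le_min normv_ge0/= mulr_ge0// ltW.
split; last by rewrite mule_ge0 ?lee_fin ?normv_ge0// sume_ge0.
pose h i y : \bar R := ((w i)%:E * (dotv v (clip y c) * p i y)%:E)%E.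
have ih i : lam.-integrable setT (h i).
  by apply: integrableZl => //; exact: integrable_clip.
have isum : lam.-integrable setT (fun y => \sum_(i < m) h i y)%E.
  by apply: (integrable_sum measurableT) => i _; exact: ih.
(* Substituting y = xi + v, by translation invariance, turns the mixture density at xi into the
   weighted sum of the [p i] at y. *)
rewrite (_ : integral _ _ _ = \int[lam]_y \sum_(i < m) h i y)%E; last first.
  have [_ <-] := preserves_integral _ _ _ (preserves_vadd lam lamE v) isum.
  apply: eq_integral => xi _; rewrite /pmix mulr_sumr -sumEFin.
  have -> : vadd v xi = vadd xi v by apply: eq_from_tnth => i; rewrite !tnth_vec addrC.
  by apply: eq_bigr => i _; rewrite /h -EFinM mulrCA.
(* Both sides are now sums over the components, compared term by term with the single-density bound
   scaled by [w i]. *)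
rewrite integral_sum// /RHS ge0_sume_distrr//; apply: lee_sum => i _.
have [phi phiE] := prad i.
have ge := clipped_expectation_ge lam lamE c v (u i) (p i) phi c0 (pd i) phiE.
rewrite integralZl//; last exact: integrable_clip.
apply: le_trans (lee_wpmul2l _ (ge _)); rewrite ?lee_fin//; last by rewrite dotvC.
rewrite !muleA -!EFinM -/(Pball i) le_eqVlt; apply/orP; left; apply/eqP.
by congr (_%:E * _)%E; ring.
Qed.
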